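(* Let $\Omega$ be any infinite set, let $\mathcal{F}$ be an ultrafilter on $\Omega$, and let $f,g\in\Omega^\Omega$. Then $\langle\operatorname{Sym}(\Omega)_{\{\mathcal{F}\}},f,g\rangle=\Omega^\Omega$ if and only if, up to renaming $f$ and $g$: $f$ is injective, $d(f)=|\Omega|$, $g$ is surjective, and either $|\Omega|$ is regular and $k(g,|\Omega|)=|\Omega|$, or $|\Omega|$ is singular and $k(g,\nu)=|\Omega|$ for all cardinals $\nu<|\Omega|$; and there exist $\Sigma\in\mathcal{F}$ and $\Gamma\subseteq\Omega$ with $\Gamma\notin\mathcal{F}$ such that one of the following holds: (i) $\Sigma f\notin\mathcal{F}$ and $\Gamma g\in\mathcal{F}$; (ii) $\Sigma g\notin\mathcal{F}$, $c(g|_\Sigma)=0$, and $\Gamma g\in\mathcal{F}$; (iii) $\Sigma f\notin\mathcal{F}$ and $\Gamma f\in\mathcal{F}$.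
   Context: $\Omega^\Omega$ is the semigroup of all mappings from $\Omega$ to itself (written to the right of their arguments and composed from left to right), and $\operatorname{Sym}(\Omega)$ is the symmetric group on $\Omega$. $\langle\,\cdot\,\rangle$ denotes the subsemigroup generated. The stabiliser of $\mathcal{F}$ is $\operatorname{Sym}(\Omega)_{\{\mathcal{F}\}}=\{f\in\operatorname{Sym}(\Omega):(\forall\Sigma\subseteq\Omega)(\Sigma\in\mathcal{F}\leftrightarrow\Sigma f\in\mathcal{F})\}$. For $f\in\Omega^\Omega$ and $\Sigma\subseteq\Omega$, $\Sigma f=\{\alpha f:\alpha\in\Sigma\}$; $d(f)=|\Omega\setminus\Omega f|$; for a cardinal $\mu\leq|\Omega|$, $k(f,\mu)=|\{\alpha\in\Omega:|\alpha f^{-1}|\geq\mu\}|$, where $\alpha f^{-1}=\{\beta\in\Omega:\beta f=\alpha\}$. For $h:\Sigma\to\Omega$, $c(h)=|\Sigma\setminus T|$ where $T\subseteq\Sigma$ is any set such that $h|_T$ is injective and $Th=\Sigma h$; thus $c(g|_\Sigma)=0$ means $g$ is injective on $\Sigma$. The phrase ''up to renaming $f$ and $g$'' applies to all the conditions that follow it, including (i)-(iii), with the same naming throughout. *)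

(* Defs.v *)
From mathcomp Require Import all_boot.
From mathcomp Require Import boolp classical_sets functions cardinality filter.

Set Implicit Arguments.
Unset Strict Implicit.
Unset Printing Implicit Defensive.

Local Open Scope classical_set_scope.
Local Open Scope card_scope.

(** Mappings act on the right in the source: [Sigma f] is [f @` Sigma],
    [alpha f^-1] is [f @^-1` [set alpha]], and the product "first f, then g" is
    [g \o f]. Cardinals are represented by sets having that cardinality. *)

Definition card_lt (T U : Type) (A : set T) (B : set U) : Prop :=
  A #<= B /\ ~ (B #<= A).

(** |T| is regular: T is not a union of fewer than |T| sets, each having fewer
    than |T| elements. Only meant for infinite T. *)
Definition regular_cardinal (T : Type) : Prop :=
  forall D : set (set T),
    card_lt D [set: T] ->
    (forall A, D A -> card_lt A [set: T]) ->
    \bigcup_(A in D) A <> [set: T].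

Definition singular_cardinal (T : Type) : Prop := ~ regular_cardinal T.

Definition semigroup_closed (T : Type) (S : set (T -> T)) : Prop :=
  forall f g : T -> T, S f -> S g -> S (g \o f).

Definition generated_semigroup (T : Type) (X : set (T -> T)) : set (T -> T) :=
  smallest (@semigroup_closed T) X.

Definition filter_stabiliser (T : Type) (F : set_system T) : set (T -> T) :=
  [set f | bijective f /\ forall S : set T, F S <-> F (f @` S)].

(** d(f) is the cardinality of [defect f]. *)
Definition defect (T : Type) (f : T -> T) : set T := ~` (f @` [set: T]).

(** k(f, mu) is the cardinality of [big_fibres f M], where mu = |M|. *)
Definition big_fibres (T U : Type) (f : T -> T) (M : set U) : set T :=
  [set a | M #<= f @^-1` [set a]].

Definition transversal_on (T : Type) (h : T -> T) (S X : set T) : Prop :=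
  [/\ X `<=` S, {in X &, injective h} & h @` X = h @` S].

(** c(h|_S) = |C|. The cardinality of [S `\` X] does not depend on the choice
    of the transversal X. *)
Definition collapse_eq (T U : Type) (h : T -> T) (S : set T) (C : set U) : Prop :=
  exists2 X : set T, transversal_on h S X & S `\` X #= C.

(** In the singular case every cardinal nu < |T| is that of some M : set T. *)
Definition cardinal_conditions (T : Type) (f g : T -> T) : Prop :=
  [/\ injective f,
      defect f #= [set: T],
      (forall y : T, exists x : T, g x = y) &
      (regular_cardinal T /\ big_fibres g [set: T] #= [set: T]) \/
      (singular_cardinal T /\
       forall M : set T, card_lt M [set: T] -> big_fibres g M #= [set: T])].

Definition filter_conditions (T : Type) (F : set_system T) (f g : T -> T) : Prop :=
  exists S G : set T,
    [/\ F S, ~ F G &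
        [\/ ~ F (f @` S) /\ F (g @` G),
            [/\ ~ F (g @` S), collapse_eq g S (@set0 T) & F (g @` G)] |
            ~ F (f @` S) /\ F (f @` G)]].

(* Main.v *)
Require Import Defs.
From mathcomp Require Import all_boot.
From mathcomp Require Import boolp classical_sets functions cardinality filter.

Set Implicit Arguments.
Unset Strict Implicit.
Unset Printing Implicit Defensive.

Local Open Scope classical_set_scope.
Local Open Scope card_scope.

(** Throughout, kappa = |T|, F is the ultrafilter, Stab its stabiliser, and a set
    is large when it has at least kappa elements; [injects T A] says that A is
    large.

    Sufficiency. The engine is an extension property of Stab: an injection
    between two sets outside F, each with a large complement, extends to an
    element of Stab, because the extension may be made to fix some member of F
    pointwise ([extend_outside]); similarly a member of F with large complement
    can be pushed by Stab into any large member of F ([push_into]). Let V be a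
    semigroup containing Stab, f and g. The hypothesis on Sigma yields an
    injection u in V whose image is outside F: either f itself, or f, followed
    by an element of Stab carrying its image into (a large version of) Sigma,
    followed by the map that throws Sigma out of F ([escaping_injection]).
    Composing u with Stab gives every injection whose image is outside F and has
    large complement ([injections_avoiding]). A map w in V with kappa fibres of
    size kappa then produces all maps into kappa points, hence all maps into any
    set outside F with large complement ([maps_into_nonmember]). The hypothesis
    on Gamma carries this into a large member of F, and Stab carries a
    transversal of g into that member; since g maps its transversal onto T,
    every map is in V ([all_maps]). If kappa is regular then w is g; if kappa is
    singular then w is g a g for a suitable a in Stab, chosen so that kappa
    fibres of w contain unions of fibres of g whose sizes exhaust kappa
    ([large_fibres_composite]).

    Necessity. Each condition is enforced by a proper subsemigroup containing
    Stab, which therefore cannot contain both f and g: the maps that are not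
    injective or are surjective, those that are not surjective or are injective,
    those whose defect is not large, those with fewer than kappa fibres that are
    large (or, for singular kappa, that exceed a bound below kappa), those that
    send no set outside F into F, and those that keep in F every member of F on
    which they are injective.

    Cardinal arithmetic is needed for arbitrary infinite types: comparability
    ([injects_total]) and kappa * kappa = kappa ([injects_square]) come from
    Zorn's lemma. *)

(** * Comparability of cardinals and squares of infinite types *)

(** The source is a type and the witness an honest function, so that no default
    elements are needed; for a type S of cardinality s this is s <= |A|. *)
Definition injects (S U : Type) (A : set U) : Prop :=
  exists2 j : S -> U, injective j & forall s, A (j s).

Lemma card_le_injects (S U : Type) (B : set S) (A : set U) :
  B #<= A <-> injects (set_type B) A.
Proof.
split.
- move=> /card_leP[f]; exists (fun s => set_val (f s)); last by move=> s; exact: set_valP.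
  move=> s t /val_inj e.
  by apply: (@inj _ _ _ f) => //; rewrite in_setE.
- case=> j jI jA; apply/card_leP.
  pose f (s : B) : A := SigSub (mem_set (jA s)).
  apply/injfunPex; exists f; first by [].
  by move=> s t _ _ [/jI].
Qed.

Lemma injects_trans (S S' U : Type) (A : set U) :
  injects S [set: S'] -> injects S' A -> injects S A.
Proof.
move=> [i iI _] [j jI jA]; exists (j \o i) => [|s]; last exact: jA.
by move=> x y /jI /iI.
Qed.

Lemma card_leTP (S U : Type) (A : set U) : [set: S] #<= A <-> injects S A.
Proof.
rewrite card_le_injects; split; apply: injects_trans.
- exists (fun s : S => SigSub (mem_set (I : [set: S] s))) => // s t.
  by case.
- by exists set_val => //; exact: val_inj.
Qed.

(** A maximal partial injection between two types is total on one of them: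
    otherwise one more pair could be added. *)
Lemma injects_total (U V : Type) : injects U [set: V] \/ injects V [set: U].
Proof.
pose P (R : set (U * V)) :=
  forall u v u' v', R (u, v) -> R (u', v') -> (u = u' <-> v = v').
have [F FP tF|R [RP Rmax]] := @Zorn_bigcup _ P.
  move=> u v u' v' [X FX Xuv] [X' FX' Xuv'].
  by have [XX'|X'X] := tF _ _ FX FX';
    [apply: (FP _ FX') => //; exact: XX' | apply: (FP _ FX) => //; exact: X'X].
have [|nU] := pselect (forall u, exists v, R (u, v)).
  move=> /choice[j jR]; left; exists j => // u u' /(RP _ _ _ _ (jR u) (jR u')).
  by [].
have [|nV] := pselect (forall v, exists u, R (u, v)).
  move=> /choice[j jR]; right; exists j => // u u'.
  by move=> /(RP _ _ _ _ (jR u) (jR u')).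
move: nU nV => /existsNP[u /forallNP Ru] /existsNP[v /forallNP Rv].
exfalso; apply: (Rmax (R `|` [set (u, v)])).
  split=> [p|]; first by left.
  by move=> /(_ (u, v) (or_intror erefl)); exact: Ru.
move=> u1 v1 u2 v2 [R1|[-> ->]] [R2|[-> ->]] //; first exact: RP.
- split=> [e|e]; first by case: (Ru v1); rewrite -e.
  by case: (Rv u1); rewrite -e.
- split=> [e|e]; first by case: (Ru v2); rewrite e.
  by case: (Rv u2); rewrite e.
Qed.

(** R is the graph of an injection of X * X into X. The set X is read off from
    the diagonal of R, which makes graphs for different X comparable by
    inclusion, as Zorn's lemma requires. *)
Definition square_injection (U : Type) (R : set (U * U * U)) : Prop :=
  let X := [set x | exists z, R (x, x, z)] in
  [/\ forall x y, (exists z, R (x, y, z)) <-> X x /\ X y,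
      forall x y z, R (x, y, z) -> X z &
      forall p z p' z', R (p, z) -> R (p', z') -> (p = p' <-> z = z')].

Lemma square_injection_bigcup (U : Type) (C : set (set (U * U * U))) :
  C `<=` @square_injection U -> total_on C subset ->
  square_injection (\bigcup_(R in C) R).
Proof.
move=> CP tC.
have join R R' : C R -> C R' -> exists R'', [/\ C R'', R `<=` R'' & R' `<=` R''].
  move=> CR CR'; have [RR'|R'R] := tC _ _ CR CR'.
    by exists R'; split.
  by exists R; split.
split=> /=.
- move=> x y; split=> [[z [R CR Rz]]|[[z [R CR Rz]] [z' [R' CR' Rz']]]].
    have [Rd _ _] := CP _ CR.
    have [[z1 ?] [z2 ?]] := (Rd x y).1 (ex_intro _ z Rz).
    by split; [exists z1 | exists z2]; exists R.
  have [R'' [CR'' /(_ _ Rz) h1 /(_ _ Rz') h2]] := join _ _ CR CR'.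
  have [Rd _ _] := CP _ CR''.
  have [|w Rw] := (Rd x y).2; first by split; [exists z | exists z'].
  by exists w, R''.
- move=> x y z [R CR Rz]; have [_ Rr _] := CP _ CR.
  by have [w Rw] := Rr _ _ _ Rz; exists w, R.
- move=> p z p' z' [R CR Rz] [R' CR' Rz'].
  have [R'' [CR'' /(_ _ Rz) h1 /(_ _ Rz') h2]] := join _ _ CR CR'.
  by have [_ _ Ri] := CP _ CR''; exact: Ri.
Qed.

Definition square_map (U : Type) (X : set U) (phi : U -> U -> U) : Prop :=
  (forall x y, X x -> X y -> X (phi x y)) /\
  (forall x y x' y', X x -> X y -> X x' -> X y' ->
     phi x y = phi x' y' -> x = x' /\ y = y').

Lemma square_map_graph (U : Type) (X : set U) phi : square_map X phi ->
  square_injection [set p : U * U * U | [/\ X p.1.1, X p.1.2 & p.2 = phi p.1.1 p.1.2]].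
Proof.
move=> [pX pI]; split=> /=.
- move=> x y; split=> [[z [Xx Xy _]]|[[_ [Xx _ _]] [_ [Xy _ _]]]].
    by split; [exists (phi x x) | exists (phi y y)].
  by exists (phi x y).
- by move=> x y z [Xx Xy ->]; exists (phi (phi x y) (phi x y)); split=> //; exact: pX.
- move=> [x y] z [x' y'] z' /= [Xx Xy ->] [Xx' Xy' ->].
  by split=> [[-> ->]//|/pI[]// -> ->].
Qed.

Lemma square_injection_map (U : Type) (R : set (U * U * U)) :
  square_injection R ->
  exists2 phi, square_map [set x | exists z, R (x, x, z)] phi &
    forall x y z, R (x, y, z) -> z = phi x y.
Proof.
move=> [Rd Rr Ri].
have /choice[phi phiR] : forall p : U * U, exists z, forall w, R (p, w) -> R (p, z).
  move=> p; have [[z Rz]|n] := pselect (exists z, R (p, z)); first by exists z.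
  by exists p.1 => w Rw; case: n; exists w.
have pR x y : (exists z, R (x, x, z)) -> (exists z, R (y, y, z)) -> R (x, y, phi (x, y)).
  by move=> Xx Xy; have [z /phiR] := (Rd x y).2 (conj Xx Xy).
exists (fun x y => phi (x, y)).
  split=> [x y Xx Xy|x y x' y' Xx Xy Xx' Xy' e]; first exact: Rr (pR _ _ Xx Xy).
  by have [] := (Ri _ _ _ _ (pR _ _ Xx Xy) (pR _ _ Xx' Xy')).2 e.
by move=> x y z Rz; apply: (Ri _ _ _ _ Rz (phiR _ _ Rz)).1.
Qed.

(** If X * X embeds in X, the square of X together with a disjoint copy j(X)
    embeds in the union: the pairs outside X * X can be sent into j(X), since
    they are of three kinds (distinguished by a, b, c), each equipotent with
    X * X. *)
Lemma square_map_extend (U : Type) (X : set U) phi (j : U -> U) (a b c : U) :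
  square_map X phi -> (forall x, X x -> ~ X (j x)) ->
  (forall x y, X x -> X y -> j x = j y -> x = y) ->
  [/\ X a, X b & X c] -> [/\ a <> b, a <> c & b <> c] ->
  exists2 phi', square_map (X `|` j @` X) phi' &
    forall x y, X x -> X y -> phi' x y = phi x y.
Proof.
move=> [pX pI] jX jI [Xa Xb Xc] [ab ac bc].
have /choice[r rP] : forall y, exists x, (X y -> x = y) /\
    ((j @` X) y -> X x /\ j x = y).
  move=> y; have [Xy|nXy] := pselect (X y).
    by exists y; split=> // -[x Xx e]; case: (jX x Xx); rewrite e.
  have [[x Xx e]|n] := pselect ((j @` X) y); first by exists x.
  by exists y.
pose code x y := if pselect (X x) then a else if pselect (X y) then b else c.
pose phi' x y := if pselect (X x /\ X y) then phi x y else
  j (phi (phi (r x) (r y)) (code x y)).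
have rX x : (X `|` j @` X) x -> X (r x).
  move=> [Xx|jx]; first by rewrite ((rP x).1 Xx).
  by have [] := (rP x).2 jx.
have cX x y : X (code x y).
  by rewrite /code; case: pselect => // ?; case: pselect.
have rI x y : (X `|` j @` X) x -> (X `|` j @` X) y -> (X x <-> X y) ->
    r x = r y -> x = y.
  move=> [Xx|jx] [Xy|jy] e; rewrite ?((rP x).1 Xx) ?((rP y).1 Xy) //.
  - by case: jy e => z Xz <- e _; case: (jX z Xz); exact/e.1.
  - by case: jx e => z Xz <- e _; case: (jX z Xz); exact/e.2.
  - by have [_ {2}<-] := (rP x).2 jx; have [_ {2}<-] := (rP y).2 jy => ->.
exists phi'; last by move=> x y Xx Xy; rewrite /phi'; case: pselect => // -[].
split=> [x y X'x X'y|x y x' y' Xx Xy Xx' Xy'].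
  rewrite /phi'; case: pselect => [[Xx Xy]|?]; first by left; exact: pX.
  right; exists (phi (phi (r x) (r y)) (code x y)) => //.
  by apply: (pX) => //; apply: pX; exact: rX.
have XX u v : X (phi (phi (r u) (r v)) (code u v)) \/ ~ (X `|` j @` X) u \/
    ~ (X `|` j @` X) v.
  have [Xu|] := pselect ((X `|` j @` X) u); last by right; left.
  have [Xv|] := pselect ((X `|` j @` X) v); last by right; right.
  by left; apply: (pX) => //; apply: pX; exact: rX.
have {}XX u v : (X `|` j @` X) u -> (X `|` j @` X) v ->
    X (phi (phi (r u) (r v)) (code u v)) by case: (XX u v) => // -[].
rewrite /phi'; case: pselect => [[h1 h2]|n] /=; case: pselect => [[h3 h4]|n'] /=.
- exact: pI.
- by move=> e; case: (jX _ (XX _ _ Xx' Xy')); rewrite -e; exact: pX.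
- by move=> e; case: (jX _ (XX _ _ Xx Xy)); rewrite e; exact: pX.
move=> /(jI _ _ (XX _ _ Xx Xy) (XX _ _ Xx' Xy')) e.
have [e' ec] : phi (r x) (r y) = phi (r x') (r y') /\ code x y = code x' y'.
  by apply: pI e => //; apply: pX; exact: rX.
have [er es] : r x = r x' /\ r y = r y' by apply: pI e'; exact: rX.
suff [e1 e2] : (X x <-> X x') /\ (X y <-> X y') by split; apply: rI.
move: ec n n'; rewrite /code.
by case: (pselect (X x)) => ?; case: (pselect (X x')) => ?;
  case: (pselect (X y)) => ?; case: (pselect (X y')) => ? //= ? n n';
  (try by [case: ab|case: ac|case: bc|case: n|case: n'|split]).
Qed.

(** Hessenberg's theorem. Take a maximal X carrying an injection of X * X into X
    and containing a fixed copy of nat. If the complement of X embeds in X, then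
    U embeds in two copies of X, hence in X, and so U * U embeds in X * X, hence
    in X; otherwise X embeds in its complement and [square_map_extend]
    contradicts maximality. *)
Lemma injects_square (U : Type) : infinite_set [set: U] ->
  injects (U * U) [set: U].
Proof.
move=> /infiniteP/card_leTP[e eI _].
have [d dI _] : injects (nat * nat) [set: nat].
  by apply/card_leTP; move: card_nat2; rewrite card_eq_le => /andP[].
have [ie ieK] : exists ie, cancel e ie.
  have /choice[ie ieP] : forall u, exists n, forall m, e m = u -> n = m.
    move=> u; have [[n <-]|n] := pselect (exists n, e n = u).
      by exists n => m /eI.
    by exists 0 => m em; case: n; exists m.
  by exists ie => n; exact: ieP.
pose N := range e.
have N0 : square_map N (fun x y => e (d (ie x, ie y))).
  split=> [x y _ _|x y x' y' [n _ <-] [m _ <-] [n' _ <-] [m' _ <-]].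
    by exists (d (ie x, ie y)).
  by move=> /eI/dI; rewrite !ieK => -[-> ->].
pose R0 : set (U * U * U) :=
  [set p | [/\ N p.1.1, N p.1.2 & p.2 = e (d (ie p.1.1, ie p.1.2))]].
have R0e n : R0 (e n, e n, e (d (n, n))).
  by split; rewrite /= ?ieK //; exists n.
(* The empty graph has to satisfy P, for the sake of the empty chain. *)
pose P (R : set (U * U * U)) :=
  square_injection R /\ ((exists p, R p) -> R0 `<=` R).
have [C CP tC|R [[Rsq RR0] Rmax]] := @Zorn_bigcup _ P.
  split; first by apply: square_injection_bigcup => // X /CP[].
  by move=> [p [X CX Xp]] q R0q; exists X => //; apply: (CP _ CX).2 => //; exists p.
have {}RR0 : R0 `<=` R.
  apply: RR0; apply: contrapT => nR; apply: (Rmax R0).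
    split=> [p Rp|h]; first by case: nR; exists p.
    by apply: nR; exists (e 0, e 0, e (d (0, 0))); exact: h.
  by split=> [|_]; [exact: square_map_graph N0 | exact: subset_refl].
have [phi phiP phiR] := square_injection_map Rsq.
set X := (X in square_map X) in phiP.
have XN n : X (e n) by exists (e (d (n, n))); exact: RR0.
have neq n m : n != m -> e n <> e m by move=> /eqP nm /eI.
suff [j jI jX] : injects U X.
  exists (fun p => phi (j p.1) (j p.2)) => // -[x y] [x' y'] /=.
  by move=> /phiP.2 []// /jI -> /jI ->.
(* The second components [e 0] and [e 1] separate X from its complement. *)
have [[j jI _]|[j jI _]] := injects_total (set_type X) (set_type (~` X)); last first.
  have jX z : X (set_val (j z)) by exact: set_valP.
  pose r u : U := match pselect (X u) with
    | left _ => phi u (e 0)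
    | right nXu => phi (set_val (j (SigSub (mem_set (nXu : (~` X) u))))) (e 1) end.
  exists r => [u v|u]; last first.
    rewrite /r; case: pselect => Xu; first exact: phiP.1.
    by apply: phiP.1 => //; exact: set_valP.
  rewrite /r; case: pselect => Xu; case: pselect => Xv.
  - by move=> e'; have [] := phiP.2 _ _ _ _ Xu (XN 0) Xv (XN 0) e'.
  - by move=> e'; have [_ /(neq 0 1 isT)] := phiP.2 _ _ _ _ Xu (XN 0) (jX _) (XN 1) e'.
  - by move=> e'; have [_ /(neq 1 0 isT)] := phiP.2 _ _ _ _ (jX _) (XN 1) Xv (XN 0) e'.
  - move=> e'; have [/val_inj/jI] := phiP.2 _ _ _ _ (jX _) (XN 1) (jX _) (XN 1) e'.
    by case.
exfalso.
have /choice[k kP] : forall u, exists v, forall Xu : X u,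
    v = set_val (j (SigSub (mem_set Xu))).
  move=> u; have [Xu|nXu] := pselect (X u); last by exists u => Xu.
  by exists (set_val (j (SigSub (mem_set Xu)))) => Xu'; rewrite (Prop_irrelevance Xu Xu').
have kX x : X x -> ~ X (k x) by move=> Xx; rewrite (kP _ Xx); exact: (set_valP (j _)).
have kI x y : X x -> X y -> k x = k y -> x = y.
  by move=> Xx Xy; rewrite (kP _ Xx) (kP _ Xy) => /val_inj/jI; case.
have [||phi' phi'P phi'E] := @square_map_extend U X phi k (e 0) (e 1) (e 2) phiP kX kI.
- by split; exact: XN.
- by split; exact: neq.
pose R' : set (U * U * U) := [set p | [/\ (X `|` k @` X) p.1.1, (X `|` k @` X) p.1.2 &
   p.2 = phi' p.1.1 p.1.2]].
have RR' : R `<=` R'.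
  move=> [[x y] z] Rz; have [Rd _ _] := Rsq.
  have [Xx Xy] := (Rd x y).1 (ex_intro _ z Rz).
  by split => /=; [left|left|rewrite phi'E // (phiR _ _ _ Rz)].
apply: (Rmax R').
  split=> // h; have Xk : (X `|` k @` X) (k (e 0)) by right; exists (e 0).
  apply: (kX (e 0)) => //; exists (phi' (k (e 0)) (k (e 0))).
  by apply: h.
split; first exact: square_map_graph.
by move=> _; exact: subset_trans RR0 RR'.
Qed.

(** * Large sets *)

Section Large.
Context (T : Type) (T_infinite : infinite_set [set: T]).

Lemma injects_sub (S U : Type) (A B : set U) : A `<=` B -> injects S A -> injects S B.
Proof. by move=> AB [j jI jA]; exists j => // s; exact: AB. Qed.

Lemma injects_of_image (S U V : Type) (h : U -> V) (A : set U) :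
  injects S (h @` A) -> injects S A.
Proof.
move=> [j jI jA].
have /choice[i iP] : forall s, exists x, A x /\ h x = j s.
  by move=> s; have [x Ax hx] := jA s; exists x.
exists i => [s t e|s]; last by have [] := iP s.
by apply: jI; rewrite -(iP s).2 -(iP t).2 e.
Qed.

Lemma injects_image (S U V : Type) (h : U -> V) (A : set U) :
  (forall x y, A x -> A y -> h x = h y -> x = y) ->
  injects S A -> injects S (h @` A).
Proof.
move=> hI [j jI jA]; exists (h \o j) => [s t /hI e|s]; first exact/jI/e.
by exists (j s).
Qed.

Lemma injects_card_lt (U : Type) (A : set U) : card_lt A [set: T] <-> ~ injects T A.
Proof.
split=> [[_ nA] /card_leTP//|nA]; split; last by move/card_leTP.
apply/card_le_injects; have [//|Tle] := injects_total (set_type A) T.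
by case: nA; apply: injects_trans Tle _; exists set_val; [exact: val_inj|exact: set_valP].
Qed.

Lemma injects_card_eq (A : set T) : A #= [set: T] <-> injects T A.
Proof.
rewrite card_eq_le; split=> [/andP[_ /card_leTP]//|/card_leTP TA].
by rewrite TA subset_card_le.
Qed.

Lemma finite_not_injects (U : Type) (A : set U) : finite_set A -> ~ injects T A.
Proof. by move=> Afin /card_leTP TA; apply: T_infinite; exact: card_le_finite Afin. Qed.

Lemma inhabited_infinite : exists x : T, True.
Proof.
by have [x _] := infinite_setN0 T_infinite; exists x.
Qed.

Lemma injects_nonempty (U : Type) (A : set U) : injects T A -> exists x, A x.
Proof. by case=> j _ jA; have [x _] := inhabited_infinite; exists (j x). Qed.

Lemma injects_bool : injects (T * bool) [set: T].
Proof.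
have [d dI _] := injects_square T_infinite.
have [a [b ab]] : exists a b : T, a <> b.
  have /infiniteP/card_leTP[e eI _] := T_infinite.
  by exists (e 0), (e 1) => /eI.
exists (fun p => d (p.1, if p.2 then a else b)) => // -[x []] [y []] /dI[->] //.
by move=> e; case: ab.
Qed.

(** Regard A and B as covering a square T * T. Either A contains a whole row, or
    every row meets B and choosing one point in each row embeds T in B. *)
Lemma injects_setU (U : Type) (A B : set U) :
  injects T (A `|` B) -> injects T A \/ injects T B.
Proof.
move=> [j jI jAB]; have [d dI _] := injects_square T_infinite.
have [[t At]|nA] := pselect (exists t, forall s, A (j (d (t, s)))).
  by left; exists (fun s => j (d (t, s))) => // s s' /jI/dI[].
right; have /choice[r rP] : forall t, exists s, B (j (d (t, s))).
  move=> t; apply: contrapT => nB; apply: nA; exists t => s.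
  by have [//|Bs] := jAB (d (t, s)); case: nB; exists s.
by exists (fun t => j (d (t, r t))) => // t t' /jI/dI[].
Qed.

Lemma injects_half (U : Type) (A : set U) : injects T A ->
  exists B, [/\ B `<=` A, injects T B & injects T (A `\` B)].
Proof.
move=> [j jI jA]; have [i iI _] := injects_bool.
exists (range (fun t => j (i (t, true)))); split.
- by move=> _ [t _ <-].
- by exists (fun t => j (i (t, true))) => [s t /jI/iI[]|t].
- exists (fun t => j (i (t, false))) => [s t /jI/iI[]//|t]; split=> //.
  by move=> [s _ /jI/iI].
Qed.

(** By comparability both factors embed in the larger one, which is its own
    square when infinite. *)
Lemma not_injects_setM (U V : Type) (A : set U) (B : set V) :
  ~ injects T A -> ~ injects T B -> ~ injects T (A `*` B).
Proof.
wlog : U V A B / injects (set_type A) [set: set_type B].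
  move=> wl nA nB; have [AB|BA] := injects_total (set_type A) (set_type B).
    exact: (wl _ _ _ _ AB).
  move=> TAB; apply: (wl _ _ _ _ BA nB nA).
  have [j jI jAB] := TAB; exists (fun t => ((j t).2, (j t).1)) => [s t [e1 e2]|t].
    by apply: jI; rewrite [LHS]surjective_pairing e1 e2 -surjective_pairing.
  by have [] := jAB t.
move=> [i iI _] nA nB [j jI jAB].
have nfB : infinite_set [set: set_type B].
  move=> finB; have finB' : finite_set B.
    by apply: card_le_finite finB; apply/card_le_injects; exists id.
  apply: (finite_not_injects (finite_setX _ finB')); last by exists j.
  apply: card_le_finite finB'; apply/card_le_injects.
  by exists (set_val \o i) => [x y /val_inj/iI//|x]; exact: set_valP.
have [d dI _] := injects_square nfB.
apply: nB; exists (fun t =>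
  set_val (d (i (SigSub (mem_set (jAB t).1)), SigSub (mem_set (jAB t).2)))).
  move=> s t /val_inj/dI[/iI[e1] e2]; apply: jI.
  by rewrite [LHS]surjective_pairing e1 e2 -surjective_pairing.
by move=> t; exact: set_valP.
Qed.

Lemma bijective_of_inj_surj (U V : Type) (q : U -> V) :
  injective q -> (forall y, exists x, q x = y) -> bijective q.
Proof.
by move=> qI /choice[r rK]; exists r => // x; apply: qI; rewrite rK.
Qed.

Lemma inj_left_inverse (S U : Type) (u : S -> U) : (exists s : S, True) ->
  injective u -> exists v, cancel u v.
Proof.
move=> [s0 _] uI.
have /choice[v vP] : forall y, exists x, forall x', u x' = y -> x = x'.
  move=> y; have [[x <-]|n] := pselect (exists x, u x = y); first by exists x => x' /uI.
  by exists s0 => x ux; case: n; exists x.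
by exists v => x; exact: vP.
Qed.

(** The two complements are equipotent to T, hence to one another. *)
Lemma extend_to_permutation (A : set T) (p : T -> T) :
  (forall x y, A x -> A y -> p x = p y -> x = y) ->
  injects T (~` A) -> injects T (~` (p @` A)) ->
  exists2 q, bijective q & forall x, A x -> q x = p x.
Proof.
move=> pI /injects_card_eq lA /injects_card_eq lpA.
have /card_bijP[b [b' bK b'K]] : ~` A #= ~` (p @` A).
  exact: card_eq_trans lA (card_esym lpA).
pose q x := match pselect ((~` A) x) with
  | left nAx => set_val (b (SigSub (mem_set nAx)))
  | right _ => p x end.
have qA x : A x -> q x = p x by move=> Ax; rewrite /q; case: pselect.
have qNA x (nAx : (~` A) x) : q x = set_val (b (SigSub (mem_set nAx))).
  by rewrite /q; case: pselect => // nAx'; rewrite (Prop_irrelevance nAx nAx').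
have bN z : ~ (p @` A) (set_val (b z)) by exact: (set_valP (b z)).
exists q => //; apply: bijective_of_inj_surj.
- move=> x y; have [Ax|nAx] := pselect (A x); have [Ay|nAy] := pselect (A y).
  + by rewrite !qA //; exact: pI.
  + by rewrite qA // qNA => e; case: (bN (SigSub (mem_set (nAy : (~` A) y)))); exists x.
  + by rewrite qNA qA // => e; case: (bN (SigSub (mem_set (nAx : (~` A) x)))); exists y.
  + by rewrite !qNA => /val_inj/(can_inj bK); case.
- move=> y; have [[x Ax <-]|nAy] := pselect ((p @` A) y); first by exists x; exact: qA.
  pose x := b' (SigSub (mem_set (nAy : (~` (p @` A)) y))).
  exists (set_val x); have nAx : (~` A) (set_val x) by exact: set_valP.
  rewrite qNA; have -> : SigSub (mem_set nAx) = x by exact: val_inj.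
  by rewrite b'K.
Qed.

Lemma transversal_extending (h : T -> T) (S D : set T) : S `<=` D ->
  (forall x y, S x -> S y -> h x = h y -> x = y) ->
  exists X, [/\ S `<=` X, X `<=` D, forall x y, X x -> X y -> h x = h y -> x = y
               & h @` X = h @` D].
Proof.
move=> SD hI.
have /choice[r rP] : forall y, exists x,
    ((h @` S) y -> S x /\ h x = y) /\ ((h @` D) y -> D x /\ h x = y).
  move=> y; have [[x Sx hx]|nS] := pselect ((h @` S) y).
    by exists x; split=> // _; split => //; exact: SD.
  have [[x Dx hx]|nD] := pselect ((h @` D) y); first by exists x; split.
  by have [x _] := inhabited_infinite; exists x; split.
have hr y : (h @` D) y -> D (r y) /\ h (r y) = y by exact: (rP y).2.
exists (r @` (h @` D)); split.
- move=> x Sx; exists (h x); first by exists x => //; exact: SD.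
  have [Sr hr'] := (rP (h x)).1 (ex_intro2 _ _ x Sx erefl).
  exact: hI.
- by move=> _ [y /hr[Dy _] <-].
- by move=> _ _ [y /hr[_ e] <-] [z /hr[_ e'] <-]; rewrite e e' => ->.
- apply/seteqP; split=> [_ [_ [y hy <-] <-]|y hy]; first by rewrite (hr y hy).2.
  by exists (r y); [exists y|exact: (hr y hy).2].
Qed.

End Large.


(** This form serves both directions: sufficiency works inside an arbitrary V,
    and necessity refutes suitable choices of V. *)
Lemma generated_semigroup_setTP (T : Type) (X : set (T -> T)) :
  generated_semigroup X = [set: T -> T] <->
  forall V, semigroup_closed V -> X `<=` V -> forall h, V h.
Proof.
split=> [XT V Vcl XV h|XT].
  have : generated_semigroup X h by rewrite XT.
  by apply: smallest_sub.
by apply/seteqP; split=> // h _ V [Vcl XV]; exact: XT.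
Qed.

(** * Ultrafilters and their stabilisers *)

Section Ultra.
Context (T : Type) (T_infinite : infinite_set [set: T]).
Context (F : set_system T) (F_ultra : UltraFilter F).

Lemma ultra_sub (A B : set T) : A `<=` B -> F A -> F B.
Proof. exact: filterS. Qed.

Lemma ultra_setC (A : set T) : F (~` A) <-> ~ F A.
Proof.
split=> [FC FA|nFA].
  have FAC : F (A `&` ~` A) by exact: filterI.
  by have [x []] := filter_ex FAC.
by have [|//] := in_ultra_setVsetC A F_ultra.
Qed.

Lemma ultra_setU (A B : set T) : F (A `|` B) -> F A \/ F B.
Proof.
move=> FAB; have [FA|/ultra_setC FA] := pselect (F A); first by left.
by right; apply: ultra_sub (filterI FAB FA) => x [[]].
Qed.

Lemma ultra_setI0 (A B : set T) : (forall x, A x -> ~ B x) -> F A -> ~ F B.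
Proof.
move=> AB FA FB; have FAB : F (A `&` B) by exact: filterI.
by have [x [/AB]] := filter_ex FAB.
Qed.

Let inj_on (h : T -> T) (A : set T) := forall x y, A x -> A y -> h x = h y -> x = y.

(** Halving A gives disjoint unions, which cannot both belong to F. Halving a
    large set is how every set below is made to avoid F, or to have a large
    complement. *)
Lemma nonmember_half_family (E : T -> set T) (A : set T) :
  (forall x y z, A x -> A y -> E x z -> E y z -> x = y) -> injects T A ->
  exists B, [/\ B `<=` A, ~ F (\bigcup_(x in B) E x), injects T B & injects T (A `\` B)].
Proof.
move=> EI /(injects_half T_infinite)[B [BA TB TAB]].
have [FB|nFB] := pselect (F (\bigcup_(x in B) E x)); last by exists B.
exists (A `\` B); split=> [x []//| | //|].
- apply: ultra_setI0 FB => z [x Bx Exz] [y [Ay nBy] Eyz].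
  by apply: nBy; rewrite -(EI x y z) //; exact: BA.
- by apply: injects_sub TB => x Bx; split; [exact: BA|case].
Qed.

Lemma nonmember_half (h : T -> T) (A : set T) : inj_on h A -> injects T A ->
  exists B, [/\ B `<=` A, ~ F (h @` B), injects T B & injects T (A `\` B)].
Proof.
move=> hI TA; have [|B [BA nFB TB TAB]] := @nonmember_half_family (fun x => [set h x]) A _ TA.
  by move=> x y z Ax Ay -> /hI; exact.
exists B; split=> //; rewrite (_ : h @` B = \bigcup_(x in B) [set h x]) //.
by apply/seteqP; split=> [_ [x Bx <-]|_ [x Bx ->]]; exists x.
Qed.

Lemma member_half (h : T -> T) (A : set T) : F (h @` A) -> injects T A ->
  exists B, [/\ B `<=` A, F (h @` B), injects T B & injects T (A `\` B)].
Proof.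
move=> FA /(injects_half T_infinite)[B [BA TB TAB]].
have [FB|nFB] := pselect (F (h @` B)); first by exists B.
exists (A `\` B); split=> [x []//| | //|].
- have [] // : F (h @` B) \/ F (h @` (A `\` B)).
  apply: ultra_setU; apply: ultra_sub FA => _ [x Ax <-].
  by have [Bx|nBx] := pselect (B x); [left|right]; exists x.
- by apply: injects_sub TB => x Bx; split; [exact: BA|case].
Qed.

Lemma stabiliser_fixing (q : T -> T) (S : set T) : F S -> (forall x, S x -> q x = x) ->
  bijective q -> filter_stabiliser F q.
Proof.
move=> FS qS qbij; split=> // A; split=> FA.
  by apply: ultra_sub (filterI FA FS) => x [Ax Sx]; exists x => //; exact: qS.
apply: ultra_sub (filterI FA FS) => _ [[x Ax <-] /qS qqx].
by rewrite (bij_inj qbij qqx).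
Qed.

Lemma stabiliser_inverse (q q' : T -> T) : cancel q q' -> cancel q' q ->
  filter_stabiliser F q -> filter_stabiliser F q'.
Proof.
move=> qK q'K [_ qF]; split=> [|A]; first by exists q.
rewrite [X in _ <-> X]qF; suff -> : q @` (q' @` A) = A by [].
apply/seteqP; split=> [_ [_ [x Ax <-] <-]|x Ax]; first by rewrite q'K.
by exists (q' x) => //; exists x.
Qed.

Lemma extend_fixing (A S : set T) (p : T -> T) : inj_on p A -> S `<=` A -> F S ->
  (forall x, S x -> p x = x) -> injects T (~` A) -> injects T (~` (p @` A)) ->
  exists2 q, filter_stabiliser F q & forall x, A x -> q x = p x.
Proof.
move=> pI SA FS pS TA TpA; have [q qbij qp] := extend_to_permutation pI TA TpA.
exists q => //; apply: (stabiliser_fixing FS) => // x Sx.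
by rewrite qp ?pS //; exact: SA.
Qed.

(** The complement B of A and its image belongs to F. If B is large, keep fixed
    a half of B that belongs to F, the other half leaving enough room; if B is
    not large, all of B can be fixed. In both cases [extend_fixing] applies to
    p extended by the identity. *)
Lemma extend_outside (A : set T) (p : T -> T) : inj_on p A ->
  ~ F A -> ~ F (p @` A) -> injects T (~` A) -> injects T (~` (p @` A)) ->
  exists2 q, filter_stabiliser F q & forall x, A x -> q x = p x.
Proof.
move=> pI nFA nFpA TA TpA.
pose B := ~` (A `|` p @` A).
have FB : F B.
  by apply/ultra_setC => /ultra_setU [].
have [S [SB FS TAS TpAS]] : exists S, [/\ S `<=` B, F S,
    injects T (~` (A `|` S)) & injects T (~` (p @` A `|` S))].
  have [TB|nTB] := pselect (injects T B).
    have [|S [SB FS _ TBS]] := @member_half id B _ TB; first by rewrite image_id.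
    exists S; split=> //; first by rewrite image_id in FS.
    - apply: injects_sub TBS => x [Bx nSx] [Ax|//].
      by apply: Bx; left.
    - apply: injects_sub TBS => x [Bx nSx] [Ax|//].
      by apply: Bx; right.
  exists B; split=> //.
  - have [//|TAB] : injects T B \/ injects T (~` (A `|` B)); last by [].
    apply: (injects_setU T_infinite); apply: injects_sub TA => x nAx.
    by have [Bx|nBx] := pselect (B x); [left|right; case].
  - have [//|TAB] : injects T B \/ injects T (~` (p @` A `|` B)); last by [].
    apply: (injects_setU T_infinite); apply: injects_sub TpA => x nAx.
    by have [Bx|nBx] := pselect (B x); [left|right; case].
pose p' x := if pselect (S x) then x else p x.
have p'S x : S x -> p' x = x by rewrite /p'; case: pselect.
have p'A x : A x -> p' x = p x.
  by move=> Ax; rewrite /p'; case: pselect => // /SB[]; left.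
have p'E : p' @` (A `|` S) = p @` A `|` S.
  apply/seteqP; split=> [_ [x [Ax|Sx] <-]|y [[x Ax <-]|Sy]].
  - by left; exists x; rewrite ?p'A.
  - by right; rewrite p'S.
  - by exists x; [left|exact: p'A].
  - by exists y; [right|exact: p'S].
have [||||||q qG qp'] := @extend_fixing (A `|` S) S p'; rewrite ?p'E //.
- move=> x y [Ax|Sx] [Ay|Sy]; rewrite ?(p'A x Ax) ?(p'A y Ay) ?(p'S x Sx) ?(p'S y Sy) //.
  + exact: pI.
  + by move=> e; case: (SB _ Sy); right; exists x.
  + by move=> e; case: (SB _ Sx); right; exists y.
- by exists q => // x Ax; rewrite qp' ?p'A //; left.
Qed.

(** Fix pointwise the points of A in a half of B that belongs to F, and inject
    the rest of A into a part of the other half. *)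
Lemma push_into (A B : set T) : F A -> F B -> injects T (~` A) -> injects T B ->
  exists a, [/\ filter_stabiliser F a, a @` A `<=` B & injects T (B `\` a @` A)].
Proof.
move=> FA FB TA TB.
have [|B1 [B1B FB1 _ TB1]] := @member_half id B _ TB; first by rewrite image_id.
rewrite image_id in FB1.
have [P [PB TP TQ]] := injects_half T_infinite TB1.
have [j jI jP] := TP.
pose p x := if pselect (B1 x) then x else j x.
have pB1 x : B1 x -> p x = x by rewrite /p; case: pselect.
have pP x : ~ B1 x -> p x = j x by rewrite /p; case: pselect.
have nB1 x : ~ B1 (j x) by have [] := PB _ (jP x).
have TQ' : injects T (B `\` p @` A).
  apply: injects_sub TQ => y [[By nB1y] nPy]; split=> // -[x Ax].
  have [B1x|nB1x] := pselect (B1 x); rewrite ?(pB1 _ B1x) ?(pP _ nB1x) // => e;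
    [apply: nB1y|apply: nPy]; by rewrite -e.
have [||||||q qG qp] := @extend_fixing A (A `&` B1) p => //.
- move=> x y _ _; have [B1x|nB1x] := pselect (B1 x);
    have [B1y|nB1y] := pselect (B1 y);
    rewrite ?(pB1 x B1x) ?(pB1 y B1y) ?(pP x nB1x) ?(pP y nB1y) //.
  + by move=> e; case: (nB1 y); rewrite -e.
  + by move=> e; case: (nB1 x); rewrite e.
  + exact: jI.
- exact: filterI FA FB1.
- by move=> x [_ /pB1].
- by apply: injects_sub TQ' => x [].
have qA : q @` A = p @` A.
  by apply/seteqP; split=> _ [x Ax <-]; exists x; rewrite ?qp.
exists q; rewrite qA; split=> // _ [x Ax <-].
have [B1x|nB1x] := pselect (B1 x); rewrite ?(pB1 _ B1x) ?(pP _ nB1x) //; first exact: B1B.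
by have [] := PB _ (jP x).
Qed.

(** * Generating all maps from a few *)

Section Sufficiency.
Context (V : set (T -> T)) (V_closed : semigroup_closed V)
  (GV : filter_stabiliser F `<=` V).

Let range_setC_large (u : T -> T) := injects T (~` range u).

(** Unless f itself works, range f belongs to F and u is f, then an element of
    Stab carrying range f into S, then h. Here S must be large; when F contains
    small sets, S is first enlarged inside a transversal of h, by a half
    whose image under h stays outside F. *)
Lemma escaping_injection (f h : T -> T) (S : set T) :
  V f -> injective f -> range_setC_large f ->
  V h -> injects T (range h) -> F S -> inj_on h S -> ~ F (h @` S) ->
  exists u, [/\ V u, injective u, ~ F (range u) & range_setC_large u].
Proof.
move=> Vf fI df Vh Th FS hI nFhS.
have [Ff|nFf] := pselect (F (range f)); last by exists f.
have [S1 [FS1 TS1 hI1 nFhS1]] :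
    exists S1, [/\ F S1, injects T S1, inj_on h S1 & ~ F (h @` S1)].
  have [X [SX _ XI hX]] := transversal_extending T_infinite (@subsetT _ S) hI.
  have TX : injects T X.
    by apply: (@injects_of_image _ _ _ h); rewrite hX.
  have [TS|nTS] := pselect (injects T S); first by exists S.
  have TXS : injects T (X `\` S).
    have [//|//] : injects T S \/ injects T (X `\` S).
    apply: (injects_setU T_infinite); apply: injects_sub TX => x Xx.
    by have [Sx|nSx] := pselect (S x); [left|right].
  have [|Y [YX nFhY TY _]] := @nonmember_half h (X `\` S) _ TXS.
    by move=> x y [Xx _] [Xy _]; exact: XI.
  have SYX : S `|` Y `<=` X by move=> x [/SX|/YX[]].
  exists (S `|` Y); split.
  - by apply: ultra_sub FS => x; left.
  - by apply: injects_sub TY => x; right.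
  - by move=> x y /SYX Xx /SYX Xy; exact: XI.
  - rewrite image_setU => /ultra_setU[]//.
have [a [aG aS1 TS1a]] := push_into Ff FS1 df TS1.
have S1a x : S1 (a (f x)) by apply: aS1; exists (f x).
exists (h \o a \o f); split.
- by apply: (V_closed Vf); apply: V_closed Vh; exact: GV.
- by move=> x y /= e; apply: fI; apply: (bij_inj aG.1); exact: hI1 e.
- by apply: contra_not nFhS1; apply: ultra_sub => _ [x _ <-]; exists (a (f x)).
- apply: injects_sub (injects_image _ TS1a).
    move=> _ [x [S1x nax] <-] [y _ e]; apply: nax.
    by exists (f y); [exists y|exact: hI1 e].
  by move=> x y [S1x _] [S1y _]; exact: hI1.
Qed.

Lemma injections_avoiding (u s : T -> T) :
  V u -> injective u -> ~ F (range u) -> range_setC_large u ->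
  injective s -> ~ F (range s) -> range_setC_large s -> V s.
Proof.
move=> Vu uI nFu du sI nFs ds.
have [v vK] := inj_left_inverse (inhabited_infinite T_infinite) uI.
have sv : (s \o v) @` range u = range s.
  apply/seteqP; split=> [_ [_ [x _ <-] <-]|_ [x _ <-]]; first by exists x => //=; rewrite vK.
  by exists (u x); [exists x|rewrite /= vK].
have [|||||a aG asv] := @extend_outside (range u) (s \o v); rewrite ?sv //.
  by move=> _ _ [x _ <-] [y _ <-] /=; rewrite !vK => /sI ->.
have -> : s = a \o u by apply/funext => x /=; rewrite asv; [rewrite /= vK|exists x].
by apply: V_closed => //; exact: GV.
Qed.

(** Fibres over K are large, so each can be halved; the left halves together
    and the right halves together are disjoint, so one of these unions A avoids
    F. Any map into K lifts through w to an injection into A, and those are in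
    V. Stabiliser elements then transport a subset of K outside F to Z. *)
Lemma maps_into_nonmember (u w : T -> T) (K : set T) :
  V u -> injective u -> ~ F (range u) -> range_setC_large u ->
  V w -> injects T K -> (forall y, K y -> injects T (w @^-1` [set y])) ->
  forall Z, ~ F Z -> injects T (~` Z) -> forall t, (forall x, Z (t x)) -> V t.
Proof.
move=> Vu uI nFu du Vw TK wK.
have /choice[j jP] : forall y, exists j : T -> T, K y ->
    injective j /\ forall x, w (j x) = y.
  move=> y; have [Ky|nKy] := pselect (K y); last by exists id.
  by have [j jI jy] := wK y Ky; exists j.
have [i iI _] := injects_bool T_infinite.
pose A b := [set x | exists y t, K y /\ x = j y (i (t, b))].
have Adisj x : A true x -> ~ A false x.
  move=> [y [t [Ky ->]]] [y' [t' [Ky' e]]].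
  have yy' : y = y' by rewrite -((jP y Ky).2 (i (t, true))) e (jP y' Ky').2.
  by rewrite -yy' in e; move/((jP y Ky).1)/iI: e.
have TA b : injects T (A b).
  have [y Ky] := injects_nonempty T_infinite TK.
  exists (fun t => j y (i (t, b))) => [s t /((jP y Ky).1)/iI[]//|t].
  by exists y, t.
have [b [nFA TnA]] : exists b, ~ F (A b) /\ injects T (~` A b).
  have [FA|nFA] := pselect (F (A true)); last first.
    exists true; split=> //; apply: injects_sub (TA false) => x Ax /Adisj.
    by [].
  exists false; split; first by apply: ultra_setI0 FA.
  exact: injects_sub (TA true).
have VK t : (forall x, K (t x)) -> V t.
  move=> Kt; pose s x := j (t x) (i (x, b)).
  have ws : t = w \o s by apply/funext=> x /=; rewrite (jP _ (Kt x)).2.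
  have sA : range s `<=` A b by move=> _ [x _ <-]; exists (t x), x.
  rewrite ws; apply: V_closed Vw; apply: (injections_avoiding Vu) => //.
  - move=> x y e; have e' : t x = t y by rewrite ws /= e.
    by move: e; rewrite /s e' => /((jP _ (Kt y)).1)/iI[].
  - by apply: contra_not nFA; exact: ultra_sub.
  - by apply: injects_sub TnA; exact: subsetC.
move=> Z nFZ TnZ t tZ.
have [|K' [K'K nFK' TK' TKK']] := @nonmember_half id K _ TK; first by [].
rewrite image_id in nFK'.
have [e eI eK'] := TK'.
have [v vK] := inj_left_inverse (inhabited_infinite T_infinite) eI.
have veZ : v @` (e @` Z) = Z.
  apply/seteqP; split=> [_ [_ [z Zz <-] <-]|z Zz]; first by rewrite vK.
  by exists (e z); rewrite ?vK //; exists z.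
have eZK' : e @` Z `<=` K' by move=> _ [z _ <-].
have [|||||a aG aev] := @extend_outside (e @` Z) v; rewrite ?veZ //.
- by move=> _ _ [x _ <-] [y _ <-]; rewrite !vK => e0; congr e.
- by apply: contra_not nFK'; exact: ultra_sub.
- by apply: injects_sub TKK' => x [_ nK'x] /eZK'.
have -> : t = a \o (e \o t) by apply/funext => x /=; rewrite aev ?vK //; exists (t x).
apply: V_closed; last exact: GV.
by apply: VK => x; apply: K'K; exact: eK'.
Qed.

(** Replace G by a set with large complement and large image under h. All maps
    into it are available, hence all maps into its image, a member of F. The stabiliser
    carries a transversal X of g into this member, so all maps into X are
    available, and g sends X onto T. The points with two preimages under g
    provide the large complement of X. *)
Lemma all_maps (u w g h : T -> T) (K G : set T) :
  V u -> injective u -> ~ F (range u) -> range_setC_large u ->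
  V w -> injects T K -> (forall y, K y -> injects T (w @^-1` [set y])) ->
  V g -> (forall y, exists x, g x = y) ->
  injects T [set y | exists x x', [/\ x <> x', g x = y & g x' = y]] ->
  V h -> injects T (range h) -> ~ F G -> F (h @` G) ->
  forall t, V t.
Proof.
move=> Vu uI nFu du Vw TK wK Vg gS g2 Vh Th nFG FhG.
have into := maps_into_nonmember Vu uI nFu du Vw TK wK.
have inj0 : inj_on h set0 by [].
have [Th' [FTh TTh VTh]] : exists Z, [/\ F Z, injects T Z &
    forall t, (forall x, Z (t x)) -> V t].
  have [X [_ _ XI hX]] := transversal_extending T_infinite (@sub0set _ setT) inj0.
  have TX : injects T X by apply: (@injects_of_image _ _ _ h); rewrite hX.
  have [|Y [YX nFY TY _]] := @nonmember_half id X _ TX; first by [].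
  rewrite image_id in nFY.
  have nFGY : ~ F (G `|` Y) by move=> /ultra_setU[].
  have FhGY : F (h @` (G `|` Y)).
    by apply: ultra_sub FhG => _ [x Gx <-]; exists x => //; left.
  have ThGY : injects T (h @` (G `|` Y)).
    apply: (@injects_sub _ _ (h @` Y)) => [_ [x Yx <-]|]; first by exists x => //; right.
    by apply: injects_image TY => x y /YX Xx /YX Xy; exact: XI.
  have [X' [_ X'GY X'I hX']] :=
    transversal_extending T_infinite (@sub0set _ (G `|` Y)) inj0.
  have TX' : injects T X' by apply: (@injects_of_image _ _ _ h); rewrite hX'.
  have [|B [BX' FhB TB TX'B]] := @member_half h X' _ TX'; first by rewrite hX'.
  exists (h @` B); split=> //.
    by apply: injects_image TB => x y /BX' Xx /BX' Xy; exact: X'I.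
  move=> t tB.
  have /choice[r rP] : forall x, exists y, B y /\ h y = t x.
    by move=> x; have [y By hy] := tB x; exists y.
  have -> : t = h \o r by apply/funext => x /=; rewrite (rP x).2.
  apply: V_closed Vh; apply: (into B) => [| |x]; last exact: (rP x).1.
  - by apply: contra_not nFGY; apply: ultra_sub; exact: subset_trans X'GY.
  - by apply: injects_sub TX'B => x [].
have gI0 : inj_on g set0 by [].
have [X [_ _ XI gX]] := transversal_extending T_infinite (@sub0set _ setT) gI0.
have TnX : injects T (~` X).
  apply: (@injects_of_image _ _ _ g); apply: injects_sub g2 => y [x [x' [xx' gx gx']]].
  have [Xx|nXx] := pselect (X x); last by exists x.
  by exists x' => // Xx'; apply: xx'; apply: XI; rewrite // gx.
suff VX t : (forall x, X (t x)) -> V t.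
  move=> t; have /choice[r rP] : forall x, exists y, X y /\ g y = t x.
    move=> x; have : (g @` X) (t x).
      by rewrite gX; have [y gy] := gS (t x); exists y.
    by move=> [y Xy gy]; exists y.
  have -> : t = g \o r by apply/funext => x /=; rewrite (rP x).2.
  by apply: V_closed Vg; apply: VX => x; exact: (rP x).1.
have [FX|nFX] := pselect (F X); last exact: into.
have [a [aG aX _]] := push_into FX FTh TnX TTh.
move=> tX; have [b aK bK] := aG.1.
have -> : t = b \o (a \o t) by apply/funext => x /=; rewrite aK.
apply: V_closed; last by apply: GV; exact: stabiliser_inverse aG.
by apply: VTh => x; apply: aX; exists (t x).
Qed.

End Sufficiency.
End Ultra.

(** * Singular cardinals: assembling full fibres *)

Section Singular.
Context (T : Type) (T_infinite : infinite_set [set: T]).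

(** A maximal partial injective choice uses fewer than |T| points, so it could
    be continued at any index where it is undefined. *)
Lemma injective_choice (J : Type) (K : J -> set T) :
  ~ injects T [set: J] -> (forall j, injects T (K j)) ->
  exists2 x : J -> T, injective x & forall j, K j (x j).
Proof.
move=> nTJ TK.
pose P (R : set (J * T)) := (forall j x, R (j, x) -> K j x) /\
  forall j x j' x', R (j, x) -> R (j', x') -> (j = j' <-> x = x').
have [C CP tC|R [[RK RI] Rmax]] := @Zorn_bigcup _ P.
  split=> [j x [R CR Rjx]|j x j' x' [R CR Rjx] [R' CR' Rjx']].
    by have [RK _] := CP _ CR; exact: RK.
  have [RR'|R'R] := tC _ _ CR CR'.
    by have [_ RI] := CP _ CR'; apply: RI => //; exact: RR'.
  by have [_ RI] := CP _ CR; apply: RI => //; exact: R'R.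
have [|nR] := pselect (forall j, exists x, R (j, x)).
  move=> /choice[x xR]; exists x => [j j' /(RI _ _ _ _ (xR j) (xR j')) //|j].
  exact: RK.
exfalso; move: nR => /existsNP[j /forallNP nRj].
pose N := [set x | exists j, R (j, x)].
have nTN : ~ injects T N.
  move=> [i iI iN]; apply: nTJ; have /choice[k kR] := iN.
  by exists k => // t t' e; apply: iI; apply/(RI _ _ _ _ (kR t) (kR t')).
have [//|] : injects T N \/ injects T (K j `\` N).
  apply: (injects_setU T_infinite); apply: injects_sub (TK j) => x Kx.
  by have [Nx|nNx] := pselect (N x); [left|right].
move=> /(injects_nonempty T_infinite)[x [Kx nNx]].
apply: (Rmax (R `|` [set (j, x)])).
  by split=> [p|]; [left|move=> /(_ (j, x) (or_intror erefl)); exact: nRj].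
split=> [j' x' [/RK//|[-> ->]//]|j1 x1 j2 x2 [R1|[-> ->]] [R2|[-> ->]] //].
- exact: RI.
- split=> [e|e]; first by case: (nRj x1); rewrite -e.
  by case: nNx; exists j1; rewrite -e.
- split=> [e|e]; first by case: (nRj x2); rewrite e.
  by case: nNx; exists j2; rewrite e.
Qed.

(** A maximal family of disjoint injective choices must be large: otherwise all
    the points it uses form a small set, and [injective_choice] in the
    complement provides one more choice. *)
Lemma injective_choice_family (J : Type) (K : J -> set T) (j0 : J) :
  ~ injects T [set: J] -> (forall j, injects T (K j)) ->
  exists2 x : T -> J -> T, (forall t j, K j (x t j)) &
    forall t j t' j', x t j = x t' j' -> t = t' /\ j = j'.
Proof.
move=> nTJ TK.
pose P (Q : set (J -> T)) := (forall z j, Q z -> K j (z j)) /\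
  forall z z' j j', Q z -> Q z' -> z j = z' j' -> z = z' /\ j = j'.
have [C CP tC|Q [[QK QI] Qmax]] := @Zorn_bigcup _ P.
  split=> [z j [Q CQ Qz]|z z' j j' [Q CQ Qz] [Q' CQ' Qz']].
    by have [QK _] := CP _ CQ; exact: QK.
  have [QQ'|Q'Q] := tC _ _ CQ CQ'.
    by have [_ QI] := CP _ CQ'; apply: QI => //; exact: QQ'.
  by have [_ QI] := CP _ CQ; apply: QI => //; exact: Q'Q.
have [[x xI xQ]|nTQ] := pselect (injects T Q).
  exists x => [t j|t j t' j' /QI[]// /xI//]; exact: QK.
exfalso; pose N := (fun p : (J -> T) * J => p.1 p.2) @` (Q `*` setT).
have nTN : ~ injects T N.
  by move=> /injects_of_image; exact: (not_injects_setM T_infinite).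
have [j|z zI zK] := @injective_choice J (fun j => K j `\` N) nTJ.
  have [//|//] : injects T N \/ injects T (K j `\` N).
  apply: (injects_setU T_infinite); apply: injects_sub (TK j) => x Kx.
  by have [Nx|nNx] := pselect (N x); [left|right].
have zN z' j j' : Q z' -> z j <> z' j'.
  by move=> Qz' e; have [_ []] := zK j; exists (z', j') => //=.
apply: (Qmax (Q `|` [set z])).
  split=> [z'|]; first by left.
  by move=> /(_ z (or_intror erefl)) Qz; exact: (zN z j0 j0 Qz).
split=> [z' j [/QK//|->]|z1 z2 j1 j2 [Q1|->] [Q2|->]].
- by have [] := zK j.
- exact: QI.
- by move=> /esym/zN; case.
- by move=> /zN; case.
- by move=> /zI ->.
Qed.

Lemma injects_set_type (S : Type) (A : set S) (B : set T) :
  injects (set_type A) B ->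
  exists2 c : S -> T, (forall x y, A x -> A y -> c x = c y -> x = y) &
    forall x, A x -> B (c x).
Proof.
move=> [j jI jB].
have /choice[c cP] : forall x, exists y, forall Ax : A x, y = j (SigSub (mem_set Ax)).
  move=> x; have [Ax|nAx] := pselect (A x).
    by exists (j (SigSub (mem_set Ax))) => Ax'; rewrite (Prop_irrelevance Ax Ax').
  by have [y _] := inhabited_infinite T_infinite; exists y => Ax.
exists c => [x y Ax Ay|x Ax]; last by rewrite (cP x Ax).
by rewrite (cP x Ax) (cP y Ay) => /jI[].
Qed.

(** Write T as the union of a small family D of small sets. There are kappa points
    y_t whose fibre under g has at least |D| elements e t A, one for each A in
    D, and one can choose pairwise distinct x t A whose fibres have at least |A|
    elements. If a maps each x t A to e t A, then the fibre of g a g over y_t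
    contains disjoint copies of all the A in D, hence is large. For a to
    exist in Stab, t is restricted to a quarter of T for which both families of
    points avoid F. *)
Lemma large_fibres_composite (F : set_system T) (F_ultra : UltraFilter F)
    (V : set (T -> T)) (g : T -> T) :
  semigroup_closed V -> filter_stabiliser F `<=` V -> V g ->
  singular_cardinal T ->
  (forall S : Type, ~ injects T [set: S] ->
     injects T [set y | injects S (g @^-1` [set y])]) ->
  exists w K, [/\ V w, injects T K & forall y, K y -> injects T (w @^-1` [set y])].
Proof.
move=> V_closed GV Vg sing gbig.
have [D [nTD nTA DT]] : exists D : set (set T), [/\ ~ injects T [set: set_type D],
    forall A, D A -> ~ injects T [set: set_type A] & \bigcup_(A in D) A = [set: T]].
  move: sing => /existsNP[D /not_implyP[/injects_card_lt nTD /not_implyP[nTA /contrapT DT]]].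
  have set_typeI (U : Type) (A : set U) : injects T [set: set_type A] -> injects T A.
    by move/injects_trans; apply; exists set_val; [exact: val_inj|exact: set_valP].
  by exists D; split=> // [/set_typeI//|A /nTA/injects_card_lt nA /set_typeI].
pose J := set_type D.
have [j0 _] : exists j : J, True.
  have [t _] := inhabited_infinite T_infinite.
  have : [set: T] t by []. rewrite -DT => -[A DA _].
  by exists (SigSub (mem_set DA)).
have [x xK xI] := @injective_choice_family J
  (fun j => [set y | injects (set_type (set_val j)) (g @^-1` [set y])]) j0 nTD
  (fun j => gbig _ (nTA _ (set_valP j))).
have [y yI yK] := gbig J nTD.
have /choice[e eP] : forall t, exists e : J -> T, injective e /\ forall j, g (e j) = y t.
  by move=> t; have [e eI ey] := yK t; exists e.
have eI t j t' j' : e t j = e t' j' -> t = t' /\ j = j'.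
  move=> E; have tt' : t = t' by apply: yI; rewrite -((eP t).2 j) E (eP t').2.
  by rewrite tt' in E *; rewrite ((eP t').1 _ _ E).
have [||Ta [_ nFx TTa _]] :=
  @nonmember_half_family T T_infinite F F_ultra (fun t => range (x t)) setT.
- by move=> t t' _ _ _ [j _ <-] [j' _ /xI[]].
- by exists id.
have [|T1 [T1a nFe TT1 TTa1]] :=
  @nonmember_half_family T T_infinite F F_ultra (fun t => range (e t)) Ta _ TTa.
- by move=> t t' _ _ _ [j _ <-] [j' _ /eI[]].
have /choice[p pP] : forall z, exists z', forall t j, z = x t j -> z' = e t j.
  move=> z; have [[t [j ->]]|n] := pselect (exists t j, z = x t j).
    by exists (e t j) => t' j' /xI[-> ->].
  by exists z => t j zx; case: n; exists t, j.
have px t j : p (x t j) = e t j by exact: pP.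
pose A := \bigcup_(t in T1) range (x t).
have pA : p @` A `<=` \bigcup_(t in T1) range (e t).
  by move=> _ [_ [t T1t [j _ <-]] <-]; exists t => //; exists j; rewrite ?px.
have [|||||a aG ap] := @extend_outside T T_infinite F F_ultra A p.
- by move=> _ _ [t _ [j _ <-]] [t' _ [j' _ <-]]; rewrite !px => /eI[-> ->].
- by apply: contra_not nFx; apply: ultra_sub => z [t /T1a Tat xt]; exists t.
- by apply: contra_not nFe; exact: ultra_sub.
- apply: injects_sub (injects_image (h := x^~ j0) _ TTa1).
    by move=> _ [t [_ nT1t] <-] [t' T1t' [j _ /xI[tt' _]]]; rewrite -tt' in nT1t.
  by move=> t t' _ _ /xI[].
- apply: injects_sub (injects_image (h := e^~ j0) _ TTa1).
    by move=> _ [t [_ nT1t] <-] /pA [t' T1t' [j _ /eI[tt' _]]]; rewrite -tt' in nT1t.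
  by move=> t t' _ _ /eI[].
exists (g \o (a \o g)), (y @` T1); split.
- apply: (V_closed _ _ _ Vg); apply: (V_closed _ _ Vg); exact: GV.
- by apply: injects_image TT1 => t t' _ _ /yI.
move=> _ [t T1t <-].
have /choice[c cP] : forall j : J, exists c : T -> T,
    (forall s s', set_val j s -> set_val j s' -> c s = c s' -> s = s') /\
    forall s, set_val j s -> g (c s) = x t j.
  by move=> j; have [c cI cx] := injects_set_type (xK t j); exists c.
have /choice[k kP] : forall s, exists j : J, set_val j s.
  move=> s; have : [set: T] s by []. rewrite -DT => -[B DB Bs].
  by exists (SigSub (mem_set DB)).
have gc s : g (c (k s) s) = x t (k s) by exact: (cP (k s)).2.
exists (fun s => c (k s) s) => [s s' E|s]; last first.
  rewrite /= gc ap ?px ?(eP t).2 //; exists t => //; exists (k s) => //.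
have kk : k s = k s' by have := gc s; rewrite E gc => /xI[].
apply: ((cP (k s)).1 _ _ (kP s)); first by rewrite kk.
by rewrite E kk.
Qed.

End Singular.

(** * Sufficiency of the conditions *)

Section SufficientConditions.
Context (T : Type) (T_infinite : infinite_set [set: T]).

Lemma big_fibres_injects (U : Type) (h : T -> T) (M : set U) (a : T) :
  big_fibres h M a <-> injects (set_type M) (h @^-1` [set a]).
Proof. exact: card_le_injects. Qed.

Lemma big_fibres_setT (h : T -> T) (a : T) :
  big_fibres h [set: T] a <-> injects T (h @^-1` [set a]).
Proof. exact: card_leTP. Qed.

Lemma collapse_eq0 (h : T -> T) (S : set T) :
  collapse_eq h S (@set0 T) <->
  forall x y, S x -> S y -> h x = h y -> x = y.
Proof.
split=> [[X [XS XI _]]|hI].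
  rewrite card_eq0 => /eqP SX x y Sx Sy.
  have SsX z : S z -> z \in X.
    move=> Sz; apply: contrapT => /negP; rewrite notin_setE => nXz.
    by have : (S `\` X) z by []; rewrite SX.
  by apply: XI; exact: SsX.
exists S; last by rewrite setDv card_eqxx.
by split=> // x y /set_mem Sx /set_mem Sy; exact: hI.
Qed.

(** Regular and singular cases are first merged into the statement [gbig] that
    for each small S there are kappa fibres of g in which S embeds. *)
Lemma conditions_sufficient (F : set_system T) (F_ultra : UltraFilter F)
    (f g : T -> T) (V : set (T -> T)) :
  semigroup_closed V -> filter_stabiliser F `<=` V -> V f -> V g ->
  cardinal_conditions f g -> filter_conditions F f g -> forall t, V t.
Proof.
move=> Vcl GV Vf Vg [fI /injects_card_eq df gS kg] [S [G [FS nFG cond]]].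
have gbig (S' : Type) : ~ injects T [set: S'] ->
    injects T [set y | injects S' (g @^-1` [set y])].
  move=> nS'; have [[i iI _]|//] := injects_total S' T.
  case: kg => [[_ /injects_card_eq]|[_ /(_ (range i)) kg]].
    by apply: injects_sub => y /big_fibres_setT; apply: injects_trans; exists i.
  have /kg/injects_card_eq : card_lt (range i) [set: T].
    by apply/injects_card_lt => /injects_of_image.
  apply: injects_sub => y /big_fibres_injects; apply: injects_trans.
  exists (fun s => SigSub (mem_set (ex_intro2 _ _ s I erefl : range i (i s)))) => //.
  by move=> s s' [/iI].
have [w [K [Vw TK wK]]] : exists w K,
    [/\ V w, injects T K & forall y, K y -> injects T (w @^-1` [set y])].
  have [reg|sing] := pselect (regular_cardinal T); last exact: large_fibres_composite gbig.
  case: kg => [[_ /injects_card_eq TK]|[/(_ reg)//]].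
  by exists g, (big_fibres g [set: T]); split=> // y /big_fibres_setT.
have g2 : injects T [set y | exists x x', [/\ x <> x', g x = y & g x' = y]].
  have nbool : ~ injects T [set: bool].
    by apply: (finite_not_injects T_infinite); exact: finite_finset.
  apply: injects_sub (gbig bool nbool) => y [i iI iy].
  by exists (i true), (i false); split; [move=> /iI|exact: iy|exact: iy].
have Tf : injects T (range f) by exists f.
have Tg : injects T (range g).
  by exists id => // y; have [x gx] := gS y; exists x.
have fin u h : [/\ V u, injective u, ~ F (range u) & injects T (~` range u)] ->
    V h -> injects T (range h) -> F (h @` G) -> forall t, V t.
  move=> [Vu uI nFu du] Vh Th FhG.
  exact: (all_maps T_infinite F_ultra Vcl GV Vu uI nFu du Vw TK wK Vg gS g2 Vh Th nFG FhG).
have esc := escaping_injection T_infinite F_ultra Vcl GV Vf fI df.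
case: cond => [[nFfS FgG]|[nFgS /collapse_eq0 SI FgG]|[nFfS FfG]].
- have [|u uP] := esc f S Vf Tf FS _ nFfS; first by move=> x y _ _ /fI.
  exact: (fin u g).
- have [u uP] := esc g S Vg Tg FS SI nFgS.
  exact: (fin u g).
- have [|u uP] := esc f S Vf Tf FS _ nFfS; first by move=> x y _ _ /fI.
  exact: (fin u f).
Qed.

End SufficientConditions.

(** * Necessity of the conditions *)

Section Necessity.
Context (T : Type) (T_infinite : infinite_set [set: T]).

Lemma exists_large_square : exists pr : T -> T,
  forall y, injects T (pr @^-1` [set y]).
Proof.
have [d dI _] := injects_square T_infinite.
have [r dK] : exists r, cancel d r.
  by apply: inj_left_inverse dI; have [x _] := inhabited_infinite T_infinite; exists (x, x).
exists (fun x => (r x).1) => y; exists (fun t => d (y, t)) => [s t /dI[]//|t].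
by rewrite /= dK.
Qed.

(** The map j throws T into a set outside F and h brings that set back onto T,
    so one of them escapes from each of the semigroups used below that concern
    injectivity, surjectivity, defect or F. *)
Lemma exists_avoiding_pair (F : set_system T) : UltraFilter F ->
  exists A j h, [/\ ~ F A, injects T (~` A), (forall x : T, A (j x)) & cancel j h].
Proof.
move=> F_ultra; have [||A [_ nFA [j jI jA] TnA]] :=
  @nonmember_half T T_infinite F F_ultra id setT; [by []|by exists id|].
have [h jK] := inj_left_inverse (inhabited_infinite T_infinite) jI.
by exists A, j, h; split=> //; [rewrite image_id in nFA|apply: injects_sub TnA => x []].
Qed.

(** A fibre of the composite is a union of fibres of h1 indexed by a fibre of
    h2; by regularity the index set or one of the members is large. *)
Lemma big_fibres_comp_regular (h1 h2 : T -> T) : regular_cardinal T ->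
  big_fibres (h2 \o h1) [set: T] `<=`
  big_fibres h2 [set: T] `|` h2 @` big_fibres h1 [set: T].
Proof.
move=> reg a /big_fibres_setT[j jI ja].
apply: contrapT => /not_orP[n2 n1].
pose E b := [set t | h1 (j t) = b].
apply: (reg (E @` (h2 @^-1` [set a]))).
- by apply/injects_card_lt => /injects_of_image ?; apply: n2; apply/big_fibres_setT.
- move=> _ [b ba <-]; apply/injects_card_lt => -[i iI iE]; apply: n1; exists b => //.
  by apply/big_fibres_setT; exists (j \o i) => [s t /jI/iI|t]; last exact: iE.
- apply/seteqP; split=> // t _; exists (E (h1 (j t))) => //.
  by exists (h1 (j t)) => //; exact: ja.
Qed.

Definition fibre_fits (S : Type) (h : T -> T) (a : T) : Prop :=
  exists k : T -> S, forall x y, h x = a -> h y = a -> k x = k y -> x = y.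

Lemma fibre_fits_comp (S1 S2 : Type) (s1 : S1) (h1 h2 : T -> T) (a : T) :
  fibre_fits S2 h2 a -> (forall b, h2 b = a -> fibre_fits S1 h1 b) ->
  fibre_fits (S2 * S1) (h2 \o h1) a.
Proof.
move=> [k2 k2I] fit1.
have /choice[k kI] : forall b, exists k : T -> S1, h2 b = a ->
    forall x y, h1 x = b -> h1 y = b -> k x = k y -> x = y.
  move=> b; have [ba|nba] := pselect (h2 b = a).
    by have [k kI] := fit1 b ba; exists k.
  by exists (fun _ => s1).
exists (fun x => (k2 (h1 x), k (h1 x) x)) => x y /= xa ya [e1 e2].
have h1xy : h1 x = h1 y by exact: k2I.
by apply: (kI (h1 y) ya) => //; rewrite -e2 h1xy.
Qed.

Lemma fibre_fits_injective (S : Type) (s : S) (h : T -> T) (a : T) :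
  injective h -> fibre_fits S h a.
Proof. by move=> hI; exists (fun _ => s) => x y <- /hI. Qed.

(** The bound is any type smaller than T, so that in the composite one can
    multiply two bounds. Fibres exceeding S, rather than fibres of size at least
    |S|, are counted: products of bounds then stay bounds without passing to
    successor cardinals. *)
Definition few_fibres_exceed (h : T -> T) : Prop :=
  exists S : Type, [/\ exists s : S, True, ~ injects T [set: S] &
    ~ injects T [set a | ~ fibre_fits S h a]].

Lemma few_fibres_exceed_closed : semigroup_closed few_fibres_exceed.
Proof.
move=> h1 h2 [S1 [[s1 _] nS1 n1]] [S2 [[s2 _] nS2 n2]].
exists (S2 * S1)%type; split; first by exists (s2, s1).
- by rewrite -setXTT; exact: not_injects_setM.
have sub : [set a | ~ fibre_fits (S2 * S1) (h2 \o h1) a] `<=`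
    [set a | ~ fibre_fits S2 h2 a] `|` h2 @` [set b | ~ fibre_fits S1 h1 b].
  move=> a /= nfit; apply: contrapT => /not_orP[/contrapT fit2 fit1].
  apply: nfit; apply: fibre_fits_comp => // b ba; apply: contrapT => nfit.
  by apply: fit1; exists b.
by move=> /(injects_sub sub)/(injects_setU T_infinite)[//|/injects_of_image].
Qed.

Lemma few_fibres_exceed_injective (h : T -> T) : injective h -> few_fibres_exceed h.
Proof.
move=> hI; exists unit; split; first by exists tt.
  apply: (finite_not_injects T_infinite); exact: finite_finset.
by move=> /(injects_nonempty T_infinite)[a []]; exact: fibre_fits_injective tt _ _ hI.
Qed.

Lemma few_fibres_exceed_small (M : set T) (h : T -> T) :
  card_lt M [set: T] -> ~ injects T (big_fibres h M) -> few_fibres_exceed h.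
Proof.
move=> /injects_card_lt nM nh.
have [m0 Mm0] : exists m, M m.
  apply: contrapT => n; apply: nh; exists id => // a.
  by apply/big_fibres_injects; exists (fun m : M => set_val m) => [x|x];
    case: n; exists (set_val x); exact: set_valP.
exists (set_type M); split; first by exists (SigSub (mem_set Mm0)).
  move=> /injects_trans lM; apply: nM; apply: lM.
  by exists set_val; [exact: val_inj|exact: set_valP].
apply: contra_not nh; apply: injects_sub => a nfit; apply/big_fibres_injects.
have [[j jI _]|[j jI _]] :=
  injects_total (set_type M) (set_type (h @^-1` [set a])).
  by exists (set_val \o j) => [x y /val_inj/jI|x]; [|exact: set_valP].
case: nfit.
have /choice[k kP] : forall x, exists m : set_type M, forall ax : (h @^-1` [set a]) x,
    m = j (SigSub (mem_set ax)).
  move=> x; have [ax|nax] := pselect ((h @^-1` [set a]) x); last first.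
    by exists (SigSub (mem_set Mm0)).
  by exists (j (SigSub (mem_set ax))) => ax'; rewrite (Prop_irrelevance ax ax').
by exists k => x y xa ya; rewrite (kP x xa) (kP y ya) => /jI[].
Qed.

Lemma no_large_defect_closed : semigroup_closed [set h : T -> T | ~ injects T (~` range h)].
Proof.
move=> h1 h2 /= n1 n2 TC.
have sub : ~` range (h2 \o h1) `<=` ~` range h2 `|` h2 @` (~` range h1).
  move=> y ny; have [[x _ xy]|nr] := pselect (range h2 y); last by left.
  right; exists x => // -[z _ zx]; by apply: ny; exists z => //; rewrite /= zx.
by have [|/injects_of_image] := injects_setU T_infinite (injects_sub sub TC).
Qed.

(** The maps without large defect, those without kappa large fibres, and those
    with [few_fibres_exceed] form semigroups containing all permutations; f belongs
    to the last two and g to the first, which forces the other generator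
    to lie outside. *)
Lemma cardinal_conditions_necessary (F : set_system T) (F_ultra : UltraFilter F)
    (f g : T -> T) :
  (forall V, semigroup_closed V -> filter_stabiliser F `|` [set f; g] `<=` V ->
     forall h, V h) ->
  injective f -> (forall y, exists x, g x = y) -> cardinal_conditions f g.
Proof.
move=> gen fI gS.
have gen2 V : semigroup_closed V -> (forall h, bijective h -> V h) -> V f -> V g ->
    forall h, V h.
  by move=> Vcl bV Vf Vg; apply: gen => // h [[hb _]|[->|->]] //; exact: bV.
have [A [j [h0 [nFA TnA jA jK]]]] := exists_avoiding_pair F_ultra.
have [pr prT] := exists_large_square.
split=> //.
- apply/injects_card_eq; apply: contrapT => nf.
  have surj_small h : (forall y, exists x, h x = y) -> ~ injects T (~` range h).
    move=> hS /(injects_nonempty T_infinite)[y []].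
    by have [x <-] := hS y; exists x.
  apply: (gen2 _ no_large_defect_closed _ _ _ j) => //.
  + by move=> h [h' hK h'K]; apply: surj_small => y; exists (h' y).
  + exact: surj_small.
  + by apply: injects_sub TnA => x nAx [y _ yx]; apply: nAx; rewrite -yx.
- have [reg|sing] := pselect (regular_cardinal T); [left|right]; split=> //.
    apply/injects_card_eq; apply: contrapT => ng.
    pose V := [set h : T -> T | ~ injects T (big_fibres h [set: T])].
    have Vinj h : injective h -> V h.
      move=> hI /(injects_nonempty T_infinite)[a /big_fibres_setT[i iI ia]].
      have /infiniteP/card_leTP[e eI _] := T_infinite.
      by have /iI/eI : i (e 0) = i (e 1) by apply: hI; rewrite (ia (e 0)) (ia (e 1)).
    have : V pr.
      apply: gen2 => //; last 2 first.
      + by move=> h hb; apply: Vinj; exact: bij_inj.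
      + exact: Vinj.
      move=> h1 h2 n1 n2 /(injects_sub (big_fibres_comp_regular reg)).
      by move=> /(injects_setU T_infinite)[//|/injects_of_image].
    by apply; exists id => // a; apply/big_fibres_setT.
  move=> M ltM; apply/injects_card_eq; apply: contrapT => ng.
  have [S [_ nS]] : few_fibres_exceed pr.
    apply: gen2 => //.
    + exact: few_fibres_exceed_closed.
    + by move=> h hb; apply: few_fibres_exceed_injective; exact: bij_inj.
    + exact: few_fibres_exceed_injective.
    + exact: few_fibres_exceed_small ng.
  apply; exists id => // a [k kI]; apply: nS.
  have [i iI ia] := prT a; exists (k \o i) => // s t /= /(kI _ _ (ia s) (ia t)).
  exact: iI.
Qed.

(** One generator must bring some set from outside F into F, since the maps that
    never do so form a semigroup; likewise one must throw out of F some member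
    on which it is injective. If f brings a set G into F then, being injective,
    it also throws out the complement of G, and the third alternative holds. If
    g brings a set into F, then the first or the second alternative holds
    according to the generator that throws a set out. *)
Lemma filter_conditions_necessary (F : set_system T) (F_ultra : UltraFilter F)
    (f g : T -> T) :
  (forall V, semigroup_closed V -> filter_stabiliser F `|` [set f; g] `<=` V ->
     forall h, V h) ->
  injective f -> filter_conditions F f g.
Proof.
move=> gen fI.
have [A [j [h0 [nFA TnA jA jK]]]] := exists_avoiding_pair F_ultra.
pose enters h := exists2 G, ~ F G & F (h @` G).
pose leaves (h : T -> T) := exists S, [/\ F S, ~ F (h @` S) &
  forall x y, S x -> S y -> h x = h y -> x = y].
have ent : enters f \/ enters g.
  apply: contrapT => /not_orP[nf ng].
  have : (~` enters) h0; last first.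
    apply; exists A => //; apply: ultra_sub (@filterT _ F _) => x _.
    by exists (j x).
  apply: gen => [h1 h2 n1 n2 [G nFG FG]|h [[_ hF]|[->|->]]//].
    apply: n2; exists (h1 @` G); last by rewrite image_comp.
    by move=> Fh1; apply: n1; exists G.
  by move=> [G nFG FG]; apply: nFG; exact: (hF G).2.
have lea : leaves f \/ leaves g.
  apply: contrapT => /not_orP[nf ng].
  have : (~` leaves) j; last first.
    apply; exists setT; split=> [| |x y _ _ /(can_inj jK)//]; first exact: filterT.
    by apply: contra_not nFA; apply: ultra_sub => _ [x _ <-].
  apply: gen => [h1 h2 n1 n2 [S [FS nFS SI]]|h [[_ hF]|[->|->]]//]; last first.
    by move=> [S [FS nFS _]]; apply: nFS; exact: (hF S).1.
  apply: n2; exists (h1 @` S); split=> [| |_ _ [x Sx <-] [y Sy <-] e].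
  - apply: contrapT => nFh1; apply: n1; exists S; split=> // x y Sx Sy e.
    by apply: SI => //=; rewrite e.
  - by rewrite image_comp.
  - by rewrite (SI x y).
have [[G nFG FfG]|[G nFG FgG]] := ent.
  exists (~` G), G; split=> //; first exact/ultra_setC.
  apply: Or33; split=> //; apply: ultra_setI0 FfG => _ [x Gx <-] [y nGy /fI yx].
  by apply: nGy; rewrite yx.
have [[S [FS nFS _]]|[S [FS nFS SI]]] := lea; exists S, G; split=> //.
  exact: Or31.
by apply: Or32; split=> //; exact/collapse_eq0.
Qed.

(** As f is not surjective, g must be: otherwise f and g both lie in the
    semigroup of maps that are not surjective or are injective. *)
Lemma both_conditions_necessary (F : set_system T) (F_ultra : UltraFilter F)
    (f g : T -> T) :
  (forall V, semigroup_closed V -> filter_stabiliser F `|` [set f; g] `<=` V ->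
     forall h, V h) ->
  injective f -> ~ (forall y, exists x, f x = y) ->
  cardinal_conditions f g /\ filter_conditions F f g.
Proof.
move=> gen fI fnS; split; last exact: filter_conditions_necessary.
apply: cardinal_conditions_necessary => //.
apply: contrapT => ngS.
have [A [j [h0 [nFA TnA jA jK]]]] := exists_avoiding_pair F_ultra.
pose V := [set h : T -> T | (forall y, exists x, h x = y) -> injective h].
have : V h0.
  apply: gen => [h1 h2 i1 i2 S12|h [[hb _] _|[->|->]]//]; last exact: bij_inj.
  have h2I : injective h2.
    by apply: i2 => y; have [x <-] := S12 y; exists (h1 x).
  apply: inj_comp => //; apply: i1 => y.
  by have [x /h2I <-] := S12 (h2 y); exists x.
move=> Vh0; have h0I : injective h0 by apply: Vh0 => y; exists (j y).
have [y nAy] := injects_nonempty T_infinite TnA.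
by apply: nAy; have <- : j (h0 y) = y by apply: h0I; rewrite jK.
Qed.

Lemma some_generator_injective (F : set_system T) (F_ultra : UltraFilter F)
    (f g : T -> T) :
  (forall V, semigroup_closed V -> filter_stabiliser F `|` [set f; g] `<=` V ->
     forall h, V h) ->
  (injective f /\ ~ (forall y, exists x, f x = y)) \/
  (injective g /\ ~ (forall y, exists x, g x = y)).
Proof.
move=> gen.
have [A [j [h0 [nFA TnA jA jK]]]] := exists_avoiding_pair F_ultra.
pose V := [set h : T -> T | injective h -> forall y, exists x, h x = y].
apply: contrapT => /not_orP[nf ng].
have : V j.
  apply: gen => [h1 h2 s1 s2 I12|h [[[h' hK h'K] _] _ y|[->|->] I]].
  - have h1I : injective h1 by exact: inj_compr I12.
    have h1S := s1 h1I.
    have h2I : injective h2.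
      move=> x y; have [x' <-] := h1S x; have [y' <-] := h1S y.
      by move=> /(I12 x' y') ->.
    by move=> y; have [x <-] := s2 h2I y; have [x' <-] := h1S x; exists x'.
  - by exists (h' y).
  - by apply: contrapT => n; apply: nf.
  - by apply: contrapT => n; apply: ng.
move=> /(_ (can_inj jK)) jS.
have [y nAy] := injects_nonempty T_infinite TnA.
by apply: nAy; have [x <-] := jS y.
Qed.

End Necessity.


Theorem corollary4p4 (Omega : Type) (Omega_infinite : infinite_set [set: Omega])
    (F : set_system Omega) (F_ultra : UltraFilter F) (f g : Omega -> Omega) :
  generated_semigroup (filter_stabiliser F `|` [set f; g])
    = [set: Omega -> Omega]
  <->
  (cardinal_conditions f g /\ filter_conditions F f g) \/
  (cardinal_conditions g f /\ filter_conditions F g f).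
Proof.
rewrite generated_semigroup_setTP; split=> [gen|cond V Vcl XV].
  have [[fI fS]|[gI gS]] := some_generator_injective Omega_infinite F_ultra gen.
    by left; exact: both_conditions_necessary.
  rewrite [X in _ `|` X]setUC in gen.
  by right; exact: both_conditions_necessary.
have GV : filter_stabiliser F `<=` V by move=> h hG; apply: XV; left.
have Vf : V f by apply: XV; right; left.
have Vg : V g by apply: XV; right; right.
by case: cond => -[]; exact: conditions_sufficient.
Qed.
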